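(* Let $f,u\colon\mathbb{R}^n\to\mathbb{R}$ be directionally differentiable in the sense of Hadamard, let $\Omega=\{x\in\mathbb{R}^n\mid u(x)\le 0\}$ and let $x^\ast\in\Omega$. Suppose that the regularity condition $\operatorname{cl}\{K_{<}(x^\ast)\}=K_{\le}(x^\ast)$ holds at $x^\ast$. Let $E^{\ast}(f)$ and $E^{\ast}(u)$ be upper exhausters, in the sense of Hadamard, of $f$ and $u$ at $x^\ast$ respectively. If $x^\ast$ is a local maximum of $f$ on $\Omega$, then $$\bigcup_{C\in E^{\ast}(u)}\left[-K^+(C)\right]\subset \bigcup_{C\in E^{\ast}(f)}\left[-K^+(C)\right].$$
   Context: A function $\varphi\colon\mathbb{R}^n\to\mathbb{R}$ is directionally differentiable in the sense of Hadamard at $x$ if for every $g\in\mathbb{R}^n$ the finite limit $\varphi'_H(x,g)=\lim_{[\alpha,g']\to[+0,g]}\frac{\varphi(x+\alpha g')-\varphi(x)}{\alpha}$ exists. A family $E^\ast(\varphi)$ of convex compact subsets of $\mathbb{R}^n$, totally bounded (i.e. all its members are contained in one common ball), is an upper exhauster of $\varphi$ at $x$ in the sense of Hadamard if $\varphi'_H(x,g)=\min_{C\in E^\ast(\varphi)}\max_{v\in C}\langle v,g\rangle$ for all $g\in\mathbb{R}^n$. The minima over the families are attained. Members of the families are nonempty sets. For $x\in\mathbb{R}^n$, $K_{<}(x)=\{g\in\mathbb{R}^n\mid u'_H(x,g)<0\}$ and $K_{\le}(x)=\{g\in\mathbb{R}^n\mid u'_H(x,g)\le 0\}$. For a convex compact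 set $C$, $K(C)=\operatorname{cone}\{C\}$ is the conic hull of $C$, and $K^+(C)=\{g\in\mathbb{R}^n\mid\langle v,g\rangle\ge 0\ \forall v\in K(C)\}$ is the conjugate cone of $K(C)$. $\operatorname{cl}$ denotes closure. *)

(* Defs.v *)
From HB Require Import structures.
From mathcomp Require Import all_boot all_order all_algebra.
From mathcomp Require Import all_classical all_reals all_analysis.
Set Implicit Arguments.
Unset Strict Implicit.
Unset Printing Implicit Defensive.
Import Order.TTheory GRing.Theory Num.Theory.
Import numFieldNormedType.Exports.
Local Open Scope classical_set_scope.
Local Open Scope ring_scope.

(* R^n is the type 'rV[R]_n of row vectors. The library's norm on it is the
   sup norm; it induces the same topology and the same bounded sets as the
   Euclidean norm, and only these are used below. *)

Definition dot (R : realType) (n : nat) (v g : 'rV[R]_n) : R :=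
  \sum_(i < n) v ord0 i * g ord0 i.

Definition hadamard_quotient (R : realType) (n : nat) (phi : 'rV[R]_n -> R)
    (x : 'rV[R]_n) (p : R * 'rV[R]_n) : R :=
  (phi (x + p.1 *: p.2) - phi x) / p.1.

(* The joint limit [alpha, g'] -> [+0, g]: alpha > 0, and g' may equal g. *)
Definition hadamard_filter (R : realType) (n : nat) (g : 'rV[R]_n) :
    set_system (R * 'rV[R]_n) :=
  filter_prod (0 : R)^'+ (nbhs g).

Definition hadamard_differentiable (R : realType) (n : nat)
    (phi : 'rV[R]_n -> R) (x : 'rV[R]_n) : Prop :=
  forall g : 'rV[R]_n, cvg (hadamard_quotient phi x @ hadamard_filter g).

(* Meaningful only when the limit exists; lim is an arbitrary value
   otherwise. *)
Definition hadamard_derive (R : realType) (n : nat) (phi : 'rV[R]_n -> R)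
    (x g : 'rV[R]_n) : R :=
  lim (hadamard_quotient phi x @ hadamard_filter g).

Definition is_max (R : realType) (A : set R) (m : R) : Prop :=
  A m /\ ubound A m.

Definition is_min (R : realType) (A : set R) (m : R) : Prop :=
  A m /\ lbound A m.

Definition totally_bounded_family (R : realType) (n : nat)
    (E : set (set 'rV[R]_n)) : Prop :=
  exists (c : 'rV[R]_n) (r : R), forall C, E C -> C `<=` ball c r.

(* The last field reads phi'_H(x, g) = min_(C in E) max_(v in C) <v, g>, the
   extrema being attained; in particular it forces E to be nonempty. *)
Record upper_exhauster (R : realType) (n : nat) (phi : 'rV[R]_n -> R)
    (x : 'rV[R]_n) (E : set (set 'rV[R]_n)) : Prop := UpperExhauster {
  exhauster_nonempty : forall C, E C -> C !=set0;
  exhauster_convex : forall C, E C -> convex_set C;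
  exhauster_compact : forall C, E C -> compact C;
  exhauster_bounded : totally_bounded_family E;
  exhauster_minmax : forall g : 'rV[R]_n,
    is_min [set m | exists2 C, E C & is_max [set dot v g | v in C] m]
           (hadamard_derive phi x g)
}.

Definition K_lt (R : realType) (n : nat) (u : 'rV[R]_n -> R)
    (x : 'rV[R]_n) : set 'rV[R]_n :=
  [set g | hadamard_derive u x g < 0].

Definition K_le (R : realType) (n : nat) (u : 'rV[R]_n -> R)
    (x : 'rV[R]_n) : set 'rV[R]_n :=
  [set g | hadamard_derive u x g <= 0].

Definition conic_hull (R : realType) (n : nat) (C : set 'rV[R]_n) :
    set 'rV[R]_n :=
  [set w | exists (k : nat) (a : 'I_k -> R) (v : 'I_k -> 'rV[R]_n),
     [/\ forall i, 0 <= a i, forall i, C (v i)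
       & w = \sum_(i < k) a i *: v i]].

Definition conjugate_cone (R : realType) (n : nat) (K : set 'rV[R]_n) :
    set 'rV[R]_n :=
  [set g | forall v, K v -> 0 <= dot v g].

Definition K_plus (R : realType) (n : nat) (C : set 'rV[R]_n) :
    set 'rV[R]_n :=
  conjugate_cone (conic_hull C).

Definition local_maximum_on (R : realType) (n : nat) (f : 'rV[R]_n -> R)
    (Omega : set 'rV[R]_n) (x : 'rV[R]_n) : Prop :=
  Omega x /\ \forall y \near x, Omega y -> f y <= f x.

(* Main.v *)
(** By the min-max formula the union of the cones [- K_plus C] over an upper
    exhauster of [phi] at [x] is exactly [K_le phi x]. Hence the inclusion to
    prove is [K_le u x `<=` K_le f x]. A direction [g] with [u'(g) <= 0] and
    [f'(g) > 0] would, by the joint limit, have a neighbourhood of directions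
    along which [f] increases strictly from [x]; regularity puts a direction
    with [u' < 0] in it, which stays in the feasible set and contradicts local
    maximality. *)
Require Import Defs.
From mathcomp Require Import all_boot all_order all_algebra.
From mathcomp Require Import all_classical all_reals all_analysis.
Import Order.TTheory GRing.Theory Num.Theory.
Import numFieldNormedType.Exports.
Local Open Scope classical_set_scope.
Local Open Scope ring_scope.

Lemma dotZl {R : realType} {n : nat} (a : R) (v g : 'rV[R]_n) :
  dot (a *: v) g = a * dot v g.
Proof.
by rewrite /dot mulr_sumr; apply: eq_bigr => i _; rewrite mxE mulrA.
Qed.

Lemma dot_suml {R : realType} {n k : nat} (v : 'I_k -> 'rV[R]_n)
    (g : 'rV[R]_n) : dot (\sum_(i < k) v i) g = \sum_(i < k) dot (v i) g.
Proof.
rewrite /dot exchange_big; apply: eq_bigr => j _ /=.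
by rewrite summxE mulr_suml.
Qed.

Lemma dotNr {R : realType} {n : nat} (v g : 'rV[R]_n) :
  dot v (- g) = - dot v g.
Proof.
by rewrite /dot -sumrN; apply: eq_bigr => i _; rewrite mxE mulrN.
Qed.

Lemma dot_continuousl {R : realType} {n : nat} (g : 'rV[R]_n) :
  continuous (fun v : 'rV[R]_n => dot v g).
Proof.
apply: continuous_big => [|i _]; first exact: add_continuous.
by move=> v; exact: (cvgMr_tmp (@coord_continuous R 1 n ord0 i v)).
Qed.

Lemma K_plusE {R : realType} {n : nat} (C : set 'rV[R]_n) :
  K_plus C = [set g | forall v, C v -> 0 <= dot v g].
Proof.
apply/seteqP; split=> g /= Cg => [v Cv|_ [k [a [v [a0 Cv ->]]]]].
  apply: Cg; exists 1%N, (fun=> 1), (fun=> v); split => //.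
  by rewrite big_ord1 scale1r.
rewrite dot_suml; apply: sumr_ge0 => i _.
by rewrite dotZl mulr_ge0// Cg.
Qed.

Lemma compact_dot_is_max {R : realType} {n : nat} (C : set 'rV[R]_n)
    (g : 'rV[R]_n) :
  C !=set0 -> compact C -> exists m, is_max [set dot v g | v in C] m.
Proof.
move=> C0 cC.
have [c /set_mem Cc cmax] :=
  EVT_max_rV C0 cC (continuous_subspaceT (dot_continuousl g)).
exists (dot c g); split; first by exists c.
by move=> _ [v Cv <-]; apply: cmax; exact: mem_set.
Qed.

Lemma K_le_upper_exhauster {R : realType} {n : nat} {phi : 'rV[R]_n -> R}
    {x : 'rV[R]_n} {E : set (set 'rV[R]_n)} :
  upper_exhauster phi x E ->
  K_le phi x = \bigcup_(C in E) [set - g | g in K_plus C].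
Proof.
move=> hE; apply/seteqP; split=> g => [g_le0|[C EC [h]]].
  (* Take the member [C] attaining the minimum at [g]: its maximum is the derivative itself, so
     [dot v g <= 0] on all of [C]. *)
  have [[C EC [_ Cmax]] _] := exhauster_minmax hE g.
  exists C => //; exists (- g); last exact: opprK.
  rewrite K_plusE => v Cv; rewrite dotNr oppr_ge0.
  by apply: le_trans g_le0; apply: Cmax; exists v.
rewrite K_plusE => Ch <-{g}; rewrite /K_le /=.
(* The minimum bounds from below only maxima that are attained, so one must first be produced for
   this [C]. *)
have [m mmax] := compact_dot_is_max C (- h) (exhauster_nonempty hE EC)
  (exhauster_compact hE EC).
have [_ minE] := exhauster_minmax hE (- h).
apply: (@le_trans _ _ m); first by apply: minE; exists C.
by have [[v Cv <-] _] := mmax; rewrite dotNr oppr_le0 Ch.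
Qed.

(** The joint limit yields a box [A * B] of steps and directions with positive quotient. Fixing [h]
    before [a] lets a density argument choose the direction first. *)
Lemma hadamard_derive_gt0 {R : realType} {n : nat} {phi : 'rV[R]_n -> R}
    {x g : 'rV[R]_n} :
  hadamard_differentiable phi x -> 0 < hadamard_derive phi x g ->
  \forall h \near g, \forall a \near (0 : R)^'+, phi x < phi (x + a *: h).
Proof.
move=> dphi /(cvgr_gt _ (dphi g))[[A B] /= [A0 Bg] AB].
near=> h; near=> a.
have : 0 < hadamard_quotient phi x (a, h).
  by apply: AB; split => /=; [near: a|near: h].
by rewrite /hadamard_quotient /= pmulr_lgt0 ?invr_gt0// subr_gt0.
Unshelve. all: by end_near. Qed.

Lemma hadamard_derive_lt0 {R : realType} {n : nat} {phi : 'rV[R]_n -> R}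
    {x g : 'rV[R]_n} :
  hadamard_differentiable phi x -> hadamard_derive phi x g < 0 ->
  \forall a \near (0 : R)^'+, phi (x + a *: g) < phi x.
Proof.
move=> dphi /(cvgr_lt _ (dphi g))[[A B] /= [A0 Bg] AB].
near=> a.
have : hadamard_quotient phi x (a, g) < 0.
  by apply: AB; split => /=; [near: a|exact: nbhs_singleton].
by rewrite /hadamard_quotient /= pmulr_llt0 ?invr_gt0// subr_lt0.
Unshelve. all: by end_near. Qed.

Lemma near_right_line {R : realType} {n : nat} {x : 'rV[R]_n}
    (g : 'rV[R]_n) {P : 'rV[R]_n -> Prop} :
  (\forall y \near x, P y) -> \forall a \near (0 : R)^'+, P (x + a *: g).
Proof.
move=> Px.
suff : x + a *: g @[a --> (0 : R)^'+] --> x by exact.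
(* Writing the limit as [x + 0 *: g] lets the sum and scaling rules apply termwise. *)
rewrite -[X in _ --> X]addr0 -[X in _ + X](scale0r g).
apply: cvgD; first exact: cvg_cst.
by apply: cvgZr_tmp; exact: cvg_at_right_filter.
Qed.

Lemma closure_K_lt_sub_K_le {R : realType} {n : nat} (f u : 'rV[R]_n -> R)
    (x : 'rV[R]_n) :
  hadamard_differentiable f x -> hadamard_differentiable u x ->
  local_maximum_on f [set y | u y <= 0] x ->
  closure (K_lt u x) `<=` K_le f x.
Proof.
move=> df du [ux0 fmax] g clg; rewrite /K_le /= leNgt; apply/negP.
(* The directions along which [f] increases form a neighbourhood of [g], so it meets [K_lt u x]. *)
move=> /(hadamard_derive_gt0 df)/clg[h [hlt hgt]].
have u_lt := hadamard_derive_lt0 du hlt.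
have f_le := near_right_line h fmax.
near (0 : R)^'+ => a.
have : f (x + a *: h) <= f x.
  have /= : u (x + a *: h) <= 0 -> f (x + a *: h) <= f x by near: a.
  (* Feasibility follows from [u (x + a *: h) < u x <= 0], whether or not the constraint is active
     at [x]. *)
  by apply; apply: le_trans ux0; apply: ltW; near: a.
by apply/negP; rewrite -ltNge; near: a.
Unshelve. all: by end_near. Qed.

Theorem theorem14 (R : realType) (n : nat) (f u : 'rV[R]_n -> R)
    (Omega : set 'rV[R]_n) (xstar : 'rV[R]_n)
    (Ef Eu : set (set 'rV[R]_n))
    (hf : forall x : 'rV[R]_n, hadamard_differentiable f x)
    (hu : forall x : 'rV[R]_n, hadamard_differentiable u x)
    (hOmega : Omega = [set x : 'rV[R]_n | u x <= 0])
    (hxstar : Omega xstar)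
    (hreg : closure (K_lt u xstar) = K_le u xstar)
    (hEf : upper_exhauster f xstar Ef)
    (hEu : upper_exhauster u xstar Eu)
    (hmax : local_maximum_on f Omega xstar) :
  \bigcup_(C in Eu) [set - g | g in K_plus C] `<=`
  \bigcup_(C in Ef) [set - g | g in K_plus C].
Proof.
subst Omega.
rewrite -(K_le_upper_exhauster hEu) -(K_le_upper_exhauster hEf) -hreg.
exact: closure_K_lt_sub_K_le.
Qed.
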